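(* Let $\mathbb{K}$ be a field of characteristic zero, $G$ a finite group, $(L,[\cdot,\cdot],\alpha)$ a multiplicative Hom-Leibniz algebra over $\mathbb{K}$ equipped with an action of $G$, let $n\ge1$, and let $(m_t,\alpha_t)$ be an equivariant $n$-deformation of $(G,L,[\cdot,\cdot],\alpha)$. Then $(m_t,\alpha_t)$ extends to an equivariant $(n+1)$-deformation if and only if the (equivariant) cohomology class of $\mathrm{Obs}^n_G\in\widetilde{CL}^3_G(L,L)$ vanishes, i.e. $\mathrm{Obs}^n_G=\partial(\phi,\psi)$ for some $(\phi,\psi)\in\widetilde{CL}^2_G(L,L)$.
   Context: A Hom-Leibniz algebra over $\mathbb{K}$ is a $\mathbb{K}$-vector space $L$ with a $\mathbb{K}$-bilinear map $[\cdot,\cdot]:L\times L\to L$ and a $\mathbb{K}$-linear map $\alpha:L\to L$ such that $[\alpha(x),[y,z]]=[[x,y],\alpha(z)]-[[x,z],\alpha(y)]$ for all $x,y,z\in L$. It is multiplicative if $\alpha([x,y])=[\alpha(x),\alpha(y)]$. An action of $G$ on it is a left action of $G$ on $L$ by $\mathbb{K}$-linear maps such that $g[x,y]=[gx,gy]$ and $\alpha(gx)=g\alpha(x)$ for all $g\in G$, $x,y\in L$. An equivariant $n$-deformation is a pair $m_t=\sum_{i=0}^n m_it^i$, $\alpha_t=\sum_{i=0}^n\alpha_it^i$ with $m_i:L\times L\to L$ $\mathbb{K}$-bilinear, $\alpha_i:L\to L$ $\mathbb{K}$-linear, $m_0=[\cdot,\cdot]$, $\alpha_0=\alpha$, $m_i(gx,gy)=gm_i(x,y)$,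 $\alpha_i(gx)=g\alpha_i(x)$ for all $g\in G$, such that, modulo $t^{n+1}$, $m_t(\alpha_t(x),m_t(y,z))=m_t(m_t(x,y),\alpha_t(z))-m_t(m_t(x,z),\alpha_t(y))$ and $m_t(\alpha_t(x),\alpha_t(y))=\alpha_t(m_t(x,y))$ for all $x,y,z\in L$. It extends to an equivariant $(n+1)$-deformation if there is $(m_{n+1},\alpha_{n+1})\in\widetilde{CL}^2_G(L,L)$ such that $(m_t+m_{n+1}t^{n+1},\ \alpha_t+\alpha_{n+1}t^{n+1})$ is an equivariant $(n+1)$-deformation. Notation: $(m_i\circ_{\alpha_j}m_k)(x,y,z)=m_i(\alpha_j(x),m_k(y,z))-m_i(m_k(x,y),\alpha_j(z))+m_i(m_k(x,z),\alpha_j(y))$. The obstruction is $\mathrm{Obs}^n_G=(\mathrm{Obs}^n_{G,\gamma},\mathrm{Obs}^n_{G,\alpha})$ with $\mathrm{Obs}^n_{G,\gamma}(x,y,z)=\sum_{i+j+k=n+1,\ 0\le i,j,k\le n}(m_i\circ_{\alpha_j}m_k)(x,y,z)$, $\mathrm{Obs}^n_{G,\alpha}(x,y)=-\sum_{i+j+k=n+1,\ 0\le i,j,k\le n}m_i(\alpha_j(x),\alpha_k(y))+\sum_{i+j=n+1,\ i,j>0}\alpha_i(m_j(x,y))$. $\widetilde{CL}^2(L,L)=\mathrm{Hom}_{\mathbb{K}}(L^{\otimes2},L)\oplus\mathrm{Hom}_{\mathbb{K}}(L,L)$, $\widetilde{CL}^3(L,L)=\mathrm{Hom}_{\mathbb{K}}(L^{\otimes3},L)\oplus\mathrm{Hom}_{\mathbb{K}}(L^{\otimes2},L)$;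 $\widetilde{CL}^n_G(L,L)\subseteq\widetilde{CL}^n(L,L)$ is the subspace of pairs whose two components are both $G$-equivariant (commute with the diagonal $G$-action on arguments). For $(\phi,\psi)\in\widetilde{CL}^2(L,L)$, $\partial(\phi,\psi)=(\partial_{\gamma\gamma}\phi-\partial_{\alpha\gamma}\psi,\ \partial_{\gamma\alpha}\phi-\partial_{\alpha\alpha}\psi)$ with $(\partial_{\gamma\gamma}\phi)(x,y,z)=[\alpha(x),\phi(y,z)]+[\phi(x,z),\alpha(y)]-[\phi(x,y),\alpha(z)]-\phi([x,y],\alpha(z))+\phi([x,z],\alpha(y))+\phi(\alpha(x),[y,z])$, $(\partial_{\alpha\gamma}\psi)(x,y,z)=[[x,y],\psi(z)]-[[x,z],\psi(y)]-[\psi(x),[y,z]]$, $(\partial_{\gamma\alpha}\phi)(x,y)=\alpha(\phi(x,y))-\phi(\alpha(x),\alpha(y))$, $(\partial_{\alpha\alpha}\psi)(x,y)=[\alpha(x),\psi(y)]+[\psi(x),\alpha(y)]-\psi([x,y])$. *)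

(* Defs.v *)
From HB Require Import structures.
From mathcomp Require Import all_boot all_fingroup all_algebra.

Set Implicit Arguments.
Unset Strict Implicit.
Unset Printing Implicit Defensive.

Import GRing.Theory.
Local Open Scope ring_scope.

Section HomLeibniz.
Variables (K : fieldType) (L : lmodType K).

Record homLeibniz := HomLeibniz {
  bracket : {bilinear L -> L -> L};
  twist : {linear L -> L};
  hom_leibniz : forall x y z,
    bracket (twist x) (bracket y z) =
    bracket (bracket x y) (twist z) - bracket (bracket x z) (twist y)
}.

Definition is_multiplicative (A : homLeibniz) : Prop :=
  forall x y, twist A (bracket A x y) = bracket A (twist A x) (twist A y).

(* MathComp's {action aT &-> T} are right actions; this is a left action. *)
Record homLeibniz_action (A : homLeibniz) (G : finGroupType) :=
  HomLeibnizAction {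
    gact : G -> {linear L -> L};
    gact1 : forall x, gact 1%g x = x;
    gactM : forall g h x, gact (g * h)%g x = gact g (gact h x);
    gact_bracket : forall g x y,
      gact g (bracket A x y) = bracket A (gact g x) (gact g y);
    gact_twist : forall g x, twist A (gact g x) = gact g (twist A x)
  }.

Definition trilinear (f : L -> L -> L -> L) : Prop :=
  [/\ forall y z, linear (fun x => f x y z),
      forall x z, linear (fun y => f x y z)
    & forall x y, linear (fun z => f x y z)].

(* Hom(L^{(x)p}, L) is rendered as the p-linear maps L x ... x L -> L. *)
Definition CL2 : Type := {bilinear L -> L -> L} * {linear L -> L}.
Definition CL3 : Type :=
  {f : L -> L -> L -> L | trilinear f} * {bilinear L -> L -> L}.

Section Linearity.
Implicit Types (f g : L -> L).

Lemma linear_addf f g : linear f -> linear g -> linear (fun x => f x + g x).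
Proof. by move=> lf lg a u v; rewrite lf lg scalerDr addrACA. Qed.

Lemma linear_oppf f : linear f -> linear (fun x => - f x).
Proof. by move=> lf a u v; rewrite lf opprD scalerN. Qed.

Lemma linear_subf f g : linear f -> linear g -> linear (fun x => f x - g x).
Proof. by move=> lf lg; apply: linear_addf => //; apply: linear_oppf. Qed.

Lemma linear_sumf (I : finType) (P : pred I) (F : I -> L -> L) :
  (forall i, linear (F i)) -> linear (fun x => \sum_(i | P i) F i x).
Proof.
move=> lF a u v; rewrite scaler_sumr -big_split /=.
by apply: eq_bigr => i _; rewrite lF.
Qed.

Lemma linear_compf f g : linear f -> linear g -> linear (fun x => f (g x)).
Proof. by move=> lf lg a u v; rewrite lg lf. Qed.

Lemma linear_idf : linear (fun x : L => x).
Proof. by []. Qed.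

Lemma linear_linf (f : {linear L -> L}) g :
  linear g -> linear (fun x => f (g x)).
Proof. by move=> lg a u v; rewrite lg linearP. Qed.

Lemma linear_bill (m : {bilinear L -> L -> L}) g w :
  linear g -> linear (fun x => m (g x) w).
Proof. by move=> lg a u v; rewrite lg linearPl. Qed.

Lemma linear_bilr (m : {bilinear L -> L -> L}) g w :
  linear g -> linear (fun x => m w (g x)).
Proof. by move=> lg a u v; rewrite lg linearPr. Qed.

End Linearity.

Ltac prove_linear :=
  repeat first [ exact: linear_idf
               | apply: linear_subf | apply: linear_addf | apply: linear_oppf
               | apply: linear_sumf => ?
               | apply: linear_linf | apply: linear_bill | apply: linear_bilr ].

Section Coboundary.
Variable A : homLeibniz.
Local Notation "[[ x , y ]]" := (bracket A x y).
Local Notation alpha := (twist A).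
Implicit Types (c : CL2) (phi : {bilinear L -> L -> L}) (psi : {linear L -> L}).

Definition d_gg phi (x y z : L) : L :=
  [[alpha x, phi y z]] + [[phi x z, alpha y]] - [[phi x y, alpha z]]
  - phi [[x, y]] (alpha z) + phi [[x, z]] (alpha y) + phi (alpha x) [[y, z]].

Definition d_ag psi (x y z : L) : L :=
  [[ [[x, y]], psi z ]] - [[ [[x, z]], psi y ]] - [[psi x, [[y, z]] ]].

Definition d_ga phi (x y : L) : L :=
  alpha (phi x y) - phi (alpha x) (alpha y).

Definition d_aa psi (x y : L) : L :=
  [[alpha x, psi y]] + [[psi x, alpha y]] - psi [[x, y]].

Definition bd_g c (x y z : L) : L := d_gg c.1 x y z - d_ag c.2 x y z.
Definition bd_a c (x y : L) : L := d_ga c.1 x y - d_aa c.2 x y.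

Lemma bd_g_trilinear c : trilinear (bd_g c).
Proof. by rewrite /bd_g /d_gg /d_ag; split=> ? ?; prove_linear. Qed.

Lemma bd_a_bilinear c : bilinear_for *:%R *:%R (bd_a c).
Proof. by rewrite /bd_a /d_ga /d_aa; split=> ?; prove_linear. Qed.

HB.instance Definition _ c :=
  bilinear_isBilinear.Build K L L L _ _ (bd_a c) (bd_a_bilinear c).

Definition coboundary c : CL3 :=
  (exist _ (bd_g c) (bd_g_trilinear c), bd_a c : {bilinear L -> L -> L}).

End Coboundary.

Section Equivariant.
Variables (A : homLeibniz) (G : finGroupType) (rho : homLeibniz_action A G).

Definition equivariant2 (c : CL2) : Prop :=
  (forall g x y, c.1 (gact rho g x) (gact rho g y) = gact rho g (c.1 x y)) /\
  (forall g x, c.2 (gact rho g x) = gact rho g (c.2 x)).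

Definition equivariant3 (c : CL3) : Prop :=
  (forall g x y z, sval c.1 (gact rho g x) (gact rho g y) (gact rho g z) =
                   gact rho g (sval c.1 x y z)) /\
  (forall g x y, c.2 (gact rho g x) (gact rho g y) = gact rho g (c.2 x y)).

Definition CL2G : Type := {c : CL2 | equivariant2 c}.
Definition CL3G : Type := {c : CL3 | equivariant3 c}.

Lemma coboundary_equivariant (c : CL2G) : equivariant3 (coboundary A (sval c)).
Proof.
case: c => c [e1 e2]; split=> g * /=.
  rewrite /bd_g /d_gg /d_ag !(gact_twist, e1, e2) -!gact_bracket.
  by rewrite !e1 !(linearB, linearD).
rewrite /bd_a /d_ga /d_aa !(gact_twist, e1, e2) -!gact_bracket.
by rewrite e2 !(linearB, linearD).
Qed.

Definition coboundaryG (c : CL2G) : CL3G :=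
  exist _ (coboundary A (sval c)) (coboundary_equivariant c).

(* A tuple D : 'I_n.+1 -> CL2G stands for
   (\sum_(i <= n) m_i t^i, \sum_(i <= n) alpha_i t^i). *)
Definition coef_m n (D : 'I_n.+1 -> CL2G) (i : 'I_n.+1) :
  {bilinear L -> L -> L} := (sval (D i)).1.
Definition coef_a n (D : 'I_n.+1 -> CL2G) (i : 'I_n.+1) :
  {linear L -> L} := (sval (D i)).2.

(* L[[t]], as coefficient sequences; x : L is the constant series.  mt and at_
   are the K[[t]]-(bi)linear extensions of m_t and alpha_t. *)
Definition series : Type := nat -> L.
Definition constS (x : L) : series := fun r => if r == 0%N then x else 0.
Definition eq_mod (N : nat) (u v : series) : Prop :=
  forall r, (r < N)%N -> u r = v r.

Definition mt n (D : 'I_n.+1 -> CL2G) (u v : series) : series := fun r =>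
  \sum_(i < n.+1) \sum_(j < r.+1) \sum_(k < r.+1 | (i + j + k == r)%N)
    coef_m D i (u j) (v k).
Definition at_ n (D : 'I_n.+1 -> CL2G) (u : series) : series := fun r =>
  \sum_(i < n.+1) \sum_(j < r.+1 | (i + j == r)%N) coef_a D i (u j).

Definition is_deformation n (D : 'I_n.+1 -> CL2G) : Prop :=
  [/\ coef_m D ord0 =2 bracket A,
      coef_a D ord0 =1 twist A,
      forall x y z : L,
        let X := constS x in let Y := constS y in let Z := constS z in
        eq_mod n.+1
          (mt D (at_ D X) (mt D Y Z))
          (mt D (mt D X Y) (at_ D Z) \- mt D (mt D X Z) (at_ D Y))
    & forall x y : L,
        let X := constS x in let Y := constS y in
        eq_mod n.+1 (mt D (at_ D X) (at_ D Y)) (at_ D (mt D X Y))].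

(* Append c as the coefficient of t^(n+1). *)
Definition add_term n (D : 'I_n.+1 -> CL2G) (c : CL2G) : 'I_n.+2 -> CL2G :=
  fun i => if unlift ord_max i is Some j then D j else c.

Definition extends_deformation n (D : 'I_n.+1 -> CL2G) : Prop :=
  exists c : CL2G, is_deformation (add_term D c).

Definition circ (m : {bilinear L -> L -> L}) (a : {linear L -> L})
    (m' : {bilinear L -> L -> L}) (x y z : L) : L :=
  m (a x) (m' y z) - m (m' x y) (a z) + m (m' x z) (a y).

Section Obstruction.
Variables (n : nat) (D : 'I_n.+1 -> CL2G).

Definition obs_g (x y z : L) : L :=
  \sum_(i < n.+1) \sum_(j < n.+1) \sum_(k < n.+1 | (i + j + k == n.+1)%N)
    circ (coef_m D i) (coef_a D j) (coef_m D k) x y z.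

Definition obs_a (x y : L) : L :=
  - (\sum_(i < n.+1) \sum_(j < n.+1) \sum_(k < n.+1 | (i + j + k == n.+1)%N)
       coef_m D i (coef_a D j x) (coef_a D k y))
  + \sum_(i < n.+1) \sum_(j < n.+1 | [&& (0 < i)%N, (0 < j)%N
                                       & (i + j == n.+1)%N])
       coef_a D i (coef_m D j x y).

Lemma obs_g_trilinear : trilinear obs_g.
Proof. by rewrite /obs_g /circ; split=> ? ?; prove_linear. Qed.

Lemma obs_a_bilinear : bilinear_for *:%R *:%R obs_a.
Proof. by rewrite /obs_a; split=> ?; prove_linear. Qed.

HB.instance Definition _ :=
  bilinear_isBilinear.Build K L L L _ _ obs_a obs_a_bilinear.

Definition obs : CL3 :=
  (exist _ obs_g obs_g_trilinear, obs_a : {bilinear L -> L -> L}).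

Lemma obs_equivariant : equivariant3 obs.
Proof.
have em i g x y : coef_m D i (gact rho g x) (gact rho g y) =
    gact rho g (coef_m D i x y) by rewrite /coef_m; case: (D i) => c [].
have ea i g x : coef_a D i (gact rho g x) = gact rho g (coef_a D i x).
  by rewrite /coef_a; case: (D i) => c [].
split=> g * /=.
  rewrite /obs_g; do 3![rewrite linear_sum; apply: eq_bigr => ? _].
  by rewrite /circ !(ea, em) !(linearB, linearD).
rewrite /obs_a linearD linearN; congr (- _ + _).
  do 3![rewrite linear_sum; apply: eq_bigr => ? _].
  by rewrite !ea em.
do 2![rewrite linear_sum; apply: eq_bigr => ? _].
by rewrite em ea.
Qed.

Definition obsG : CL3G := exist _ obs obs_equivariant.

End Obstruction.
End Equivariant.
End HomLeibniz.

(* Main.v *)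
(* The coefficient of t^(n+1) in the two deformation equations for
   (m_t + phi t^(n+1), alpha_t + psi t^(n+1)) is Obs^n + d(phi, psi): the terms
   free of phi and psi sum to the obstruction, and in the others the remaining
   two indices vanish.  As the lower coefficients are untouched, (phi, psi)
   extends the deformation iff Obs^n = d(- phi, - psi). *)
From HB Require Import structures.
Require Import Defs.
From mathcomp Require Import all_boot all_fingroup all_algebra.
From mathcomp Require Import zify.
From mathcomp Require boolp.

Set Implicit Arguments.
Unset Strict Implicit.
Unset Printing Implicit Defensive.

Import GRing.Theory.
Local Open Scope ring_scope.

(** * Sums over indices of fixed total, and their corner terms *)

Section FiniteSums.
Variable V : nmodType.

Lemma sum_ord_trunc (F : nat -> V) N M :
  (forall i, (N <= i)%N -> F i = 0) -> (forall i, (M <= i)%N -> F i = 0) ->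
  \sum_(i < N) F i = \sum_(i < M) F i.
Proof.
move=> FN FM; wlog leNM : N M FN FM / (N <= M)%N => [IH|].
  by case/orP: (leq_total N M) => /IH ->.
rewrite (big_ord_widen _ F leNM) big_mkcond; apply: eq_bigr => i _.
by case: ltnP => // /FN.
Qed.

Lemma sum_ord_recr_cond (P : pred nat) (F : nat -> V) N :
  \sum_(k < N.+1 | P k) F k =
  \sum_(k < N | P k) F k + (if P N then F N else 0).
Proof. by rewrite big_mkcond big_ord_recr -big_mkcond. Qed.

Lemma sum_ord_only0 (F : nat -> V) N :
  (forall i, (0 < i)%N -> F i = 0) -> \sum_(i < N.+1) F i = F 0%N.
Proof. by move=> F0; rewrite big_ord_recl big1 ?addr0 // => i _; exact: F0. Qed.

(** An index equal to [N.+1] exhausts the total and forces the other to be 0, so only two corner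
    terms distinguish the two ranges. With [N := n] these are the terms containing an appended
    coefficient. *)
Lemma sum2_ord_recr (F : nat -> nat -> V) N :
  \sum_(i < N.+2) \sum_(j < N.+2 | (i + j == N.+1)%N) F i j =
  \sum_(i < N.+1) \sum_(j < N.+1 | (i + j == N.+1)%N) F i j
  + (F N.+1 0%N + F 0%N N.+1).
Proof.
have -> : \sum_(i < N.+2) \sum_(j < N.+2 | (i + j == N.+1)%N) F i j =
   \sum_(i < N.+1) \sum_(j < N.+2 | (i + j == N.+1)%N) F i j + F N.+1 0%N.
  rewrite big_ord_recr; congr (_ + _); rewrite big_mkcond /=.
  rewrite (sum_ord_only0 (F := fun j =>
    if (N.+1 + j == N.+1)%N then F N.+1 j else 0)) ?addn0 ?eqxx // => j j0.
  by rewrite ifN //; lia.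
rewrite [_ N.+1 _ + _]addrC addrA; congr (_ + _).
under eq_bigr => i _.
  rewrite (sum_ord_recr_cond (fun j => i + j == N.+1)%N (F i)).
over.
rewrite big_split; congr (_ + _).
rewrite (sum_ord_only0 (F := fun i =>
    if (i + N.+1 == N.+1)%N then F i N.+1 else 0)) ?eqxx // => i i0.
by rewrite ifN //; lia.
Qed.

Lemma sum3_ord_recr (F : nat -> nat -> nat -> V) N :
  \sum_(i < N.+2) \sum_(j < N.+2) \sum_(k < N.+2 | (i + j + k == N.+1)%N)
     F i j k =
  \sum_(i < N.+1) \sum_(j < N.+1) \sum_(k < N.+1 | (i + j + k == N.+1)%N)
     F i j k
  + (F N.+1 0%N 0%N + F 0%N N.+1 0%N + F 0%N 0%N N.+1).
Proof.
(* The innermost sum collapses to [k = 0] when [i + j = N.+1] and is empty beyond that. Hence the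
   top values of [i] and [j] are peeled off first, and the top value of [k] afterwards. *)
pose S i j := \sum_(k < N.+2 | (i + j + k == N.+1)%N) F i j k.
have S_top i j : (i + j = N.+1)%N -> S i j = F i j 0%N.
  move=> ij; rewrite /S big_mkcond ij.
  rewrite (sum_ord_only0 (F := fun k =>
    if (N.+1 + k == N.+1)%N then F i j k else 0)) ?addn0 ?eqxx // => k k0.
  by rewrite ifN //; lia.
have S_gt i j : (i + j > N.+1)%N -> S i j = 0.
  by move=> ij; rewrite /S big_pred0 // => k; lia.
have -> : \sum_(i < N.+2) \sum_(j < N.+2) S i j =
    \sum_(i < N.+1) \sum_(j < N.+1) S i j + F 0%N N.+1 0%N + F N.+1 0%N 0%N.
  rewrite big_ord_recr /= (sum_ord_only0 (F := S N.+1)); last first.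
    by move=> j j0; apply: S_gt; lia.
  rewrite S_top ?addn0 //; congr (_ + _).
  under eq_bigr => i _ do rewrite big_ord_recr.
  rewrite big_split /= (sum_ord_only0 (F := S^~ N.+1)) ?S_top // => i i0.
  by apply: S_gt; lia.
have -> : \sum_(i < N.+1) \sum_(j < N.+1) S i j =
    \sum_(i < N.+1) \sum_(j < N.+1) \sum_(k < N.+1 | (i + j + k == N.+1)%N)
      F i j k + F 0%N 0%N N.+1.
  under eq_bigr => i _.
    under eq_bigr => j _ do
      rewrite /S (sum_ord_recr_cond (fun k => i + j + k == N.+1)%N (F i j)).
    rewrite big_split.
  over.
  rewrite big_split /=; congr (_ + _).
  rewrite (sum_ord_only0 (F := fun i => \sum_(j < N.+1)
      if (i + j + N.+1 == N.+1)%N then F i j N.+1 else 0)) => [|i i0].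
    rewrite (sum_ord_only0 (F := fun j =>
      if (0 + j + N.+1 == N.+1)%N then F 0%N j N.+1 else 0)) ?eqxx // => j j0.
    by rewrite ifN //; lia.
  by rewrite big1 // => j _; rewrite ifN //; lia.
by rewrite -!addrA; congr (_ + _); rewrite addrC -addrA addrCA.
Qed.

End FiniteSums.

(** * Extensionality and negation of cochains *)

Section Bundles.
Variables (K : fieldType) (L : lmodType K).

(** Apart from the function, the bundle holds only proofs of propositions, so functional
    extensionality and proof irrelevance suffice. *)
Lemma bilinear_ext (f g : {bilinear L -> L -> L}) : f =2 g -> f = g.
Proof.
case: f g => [f [[p1 p2 p3 p4]]] [g [[q1 q2 q3 q4]]] /= fg.
have efg : f = g by apply: boolp.funext => x; apply: boolp.funext.
subst g; congr Bilinear.Pack; congr Bilinear.Class.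
by congr isBilinear.Axioms_; apply: boolp.Prop_irrelevance.
Qed.

Lemma CL3_ext (c d : CL3 L) :
  (forall x y z, sval c.1 x y z = sval d.1 x y z) -> c.2 =2 d.2 -> c = d.
Proof.
case: c d => [[f pf] b] [[g pg] b'] /= fg /bilinear_ext ->; congr pair.
apply: boolp.eq_exist.
by do 3![apply: boolp.funext => ?].
Qed.

Definition opp_bilin (f : {bilinear L -> L -> L}) (x y : L) : L := - f x y.

Fact opp_bilin_is_bilinear f : bilinear_for *:%R *:%R (opp_bilin f).
Proof.
split=> w a u v; rewrite /opp_bilin.
  by rewrite linearPl opprD -scalerN.
by rewrite linearPr opprD -scalerN.
Qed.

HB.instance Definition _ f :=
  bilinear_isBilinear.Build K L L L _ _ (opp_bilin f) (opp_bilin_is_bilinear f).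

(** A term extending the deformation and a cochain with coboundary [obs] differ by this sign. *)
Definition opp_CL2 (c : CL2 L) : CL2 L :=
  (opp_bilin c.1 : {bilinear L -> L -> L}, \- c.2 : {linear L -> L}).

Variable A : homLeibniz L.

Lemma bd_gN c x y z : bd_g A (opp_CL2 c) x y z = - bd_g A c x y z.
Proof.
rewrite /bd_g /d_gg /d_ag /= /opp_bilin.
by rewrite !(linearNl, linearNr, opprD, opprK).
Qed.

Lemma bd_aN c x y : bd_a A (opp_CL2 c) x y = - bd_a A c x y.
Proof.
rewrite /bd_a /d_ga /d_aa /= /opp_bilin.
by rewrite !(linearN, linearNl, linearNr, opprD, opprK).
Qed.

Variables (G : finGroupType) (rho : homLeibniz_action A G).

Lemma opp_CL2_equivariant (c : CL2G rho) : equivariant2 rho (opp_CL2 (sval c)).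
Proof.
case: c => c [e1 e2]; split=> g * /=; first by rewrite /opp_bilin e1 linearN.
by rewrite e2 linearN.
Qed.

Definition opp_CL2G (c : CL2G rho) : CL2G rho :=
  exist _ (opp_CL2 (sval c)) (opp_CL2_equivariant c).

End Bundles.

(** * Coefficients of the deformation equations *)

Section Extension.
Variables (K : fieldType) (L : lmodType K) (A : homLeibniz L).
Variables (G : finGroupType) (rho : homLeibniz_action A G).

(* Extending the coefficient families by zero to all of nat lets truncated and
   extended deformations be compared index by index. *)
Definition nat_m n (D : 'I_n.+1 -> CL2G rho) (i : nat) (x y : L) : L :=
  oapp (fun k => coef_m D k x y) 0 (insub i).
Definition nat_a n (D : 'I_n.+1 -> CL2G rho) (i : nat) (x : L) : L :=
  oapp (fun k => coef_a D k x) 0 (insub i).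

Section Coefficients.
Variables (n : nat) (D : 'I_n.+1 -> CL2G rho).

Lemma nat_m_ord (i : 'I_n.+1) : nat_m D i =2 coef_m D i.
Proof. by move=> x y; rewrite /nat_m valK. Qed.

Lemma nat_a_ord (i : 'I_n.+1) : nat_a D i =1 coef_a D i.
Proof. by move=> x; rewrite /nat_a valK. Qed.

Lemma nat_m_gt i x y : (n < i)%N -> nat_m D i x y = 0.
Proof. by move=> ni; rewrite /nat_m insubN // -leqNgt. Qed.

Lemma nat_a_gt i x : (n < i)%N -> nat_a D i x = 0.
Proof. by move=> ni; rewrite /nat_a insubN // -leqNgt. Qed.

Lemma nat_m0l i y : nat_m D i 0 y = 0.
Proof. by rewrite /nat_m; case: insub => //= k; rewrite linear0l. Qed.

Lemma nat_m0r i x : nat_m D i x 0 = 0.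
Proof. by rewrite /nat_m; case: insub => //= k; rewrite linear0r. Qed.

Lemma nat_a0 i : nat_a D i 0 = 0.
Proof. by rewrite /nat_a; case: insub => //= k; rewrite linear0. Qed.

(** The range of [i] can be changed from [n] to [r]: beyond [n] the coefficients vanish, and beyond
    [r] no [j], [k] satisfy [i + j + k = r]. *)
Lemma mtE u v r : mt D u v r =
  \sum_(i < r.+1) \sum_(j < r.+1) \sum_(k < r.+1 | (i + j + k == r)%N)
    nat_m D i (u j) (v k).
Proof.
pose F i := \sum_(j < r.+1) \sum_(k < r.+1 | (i + j + k == r)%N)
  nat_m D i (u j) (v k).
rewrite -(sum_ord_trunc (F := F) (N := n.+1)).
- rewrite /mt; apply: eq_bigr => i _.
  by do 2![apply: eq_bigr => ? _]; rewrite nat_m_ord.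
- by move=> i ni; do 2![rewrite /F big1 // => ? _]; rewrite nat_m_gt.
by move=> i ri; rewrite /F big1 // => j _; rewrite big_pred0 // => k; lia.
Qed.

Lemma at_E u r :
  at_ D u r = \sum_(i < r.+1) \sum_(j < r.+1 | (i + j == r)%N) nat_a D i (u j).
Proof.
pose F i := \sum_(j < r.+1 | (i + j == r)%N) nat_a D i (u j).
rewrite -(sum_ord_trunc (F := F) (N := n.+1)).
- rewrite /at_; apply: eq_bigr => i _.
  by apply: eq_bigr => j _; rewrite nat_a_ord.
- by move=> i ni; rewrite /F big1 // => ? _; rewrite nat_a_gt.
by move=> i ri; rewrite /F big_pred0 // => k; lia.
Qed.

(** Both arguments live in degree 0, so only [i = r], [j = k = 0] contributes: if [i < r], then [j]
    or [k] is positive and meets a zero of [constS]. *)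
Lemma mt_const x y r : mt D (constS x) (constS y) r = nat_m D r x y.
Proof.
rewrite mtE big_ord_recr /= big1 ?add0r => [|i _]; last first.
  rewrite big1 // => j _; rewrite big1 // => k /eqP ijk.
  have i_r := ltn_ord i; rewrite /constS.
  have [j0|_] := eqVneq (j : nat) 0%N; last by rewrite nat_m0l.
  by rewrite ifN ?nat_m0r //; lia.
rewrite (sum_ord_only0 (F := fun j =>
  \sum_(k < r.+1 | (r + j + k == r)%N) nat_m D r (constS x j) (constS y k))).
  rewrite big_mkcond /= (sum_ord_only0 (F := fun k => if (r + 0 + k == r)%N
    then nat_m D r (constS x 0%N) (constS y k) else 0)) ?addn0 ?eqxx //.
  by move=> k k0; rewrite ifN //; lia.
by move=> j j0; rewrite big_pred0 // => k; lia.
Qed.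

Lemma at_const x r : at_ D (constS x) r = nat_a D r x.
Proof.
rewrite at_E big_ord_recr /= big1 ?add0r => [|i _]; last first.
  rewrite big1 // => j /eqP ij; have i_r := ltn_ord i.
  by rewrite /constS ifN ?nat_a0 //; lia.
rewrite big_mkcond /= (sum_ord_only0 (F := fun k => if (r + k == r)%N
  then nat_a D r (constS x k) else 0)) ?addn0 ?eqxx //.
by move=> k k0; rewrite ifN //; lia.
Qed.

Definition nat_circ i j k x y z : L :=
  nat_m D i (nat_a D j x) (nat_m D k y z)
  - nat_m D i (nat_m D k x y) (nat_a D j z)
  + nat_m D i (nat_m D k x z) (nat_a D j y).

Definition leibniz_coef r x y z : L :=
  \sum_(i < r.+1) \sum_(j < r.+1) \sum_(k < r.+1 | (i + j + k == r)%N)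
    nat_circ i j k x y z.

(** The defect of multiplicativity in order [r], taken as right side minus left side to agree with
    the sign of [obs_a]. *)
Definition mult_coef r x y : L :=
  - (\sum_(i < r.+1) \sum_(j < r.+1) \sum_(k < r.+1 | (i + j + k == r)%N)
       nat_m D i (nat_a D j x) (nat_a D k y))
  + \sum_(i < r.+1) \sum_(j < r.+1 | (i + j == r)%N) nat_a D i (nat_m D j x y).

Lemma leibniz_coefE r x y z :
  let X := constS x in let Y := constS y in let Z := constS z in
  leibniz_coef r x y z =
  mt D (at_ D X) (mt D Y Z) r
  - (mt D (mt D X Y) (at_ D Z) r - mt D (mt D X Z) (at_ D Y) r).
Proof.
(* In the last two terms of [nat_circ] the twist sits in the second slot of the outer product, where
   [mt] uses the index [k]; exchanging [j] and [k] makes [j] the index of the twist throughout. *)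
have swap (F : nat -> nat -> nat -> L) :
    \sum_(i < r.+1) \sum_(j < r.+1) \sum_(k < r.+1 | (i + j + k == r)%N)
      F i j k =
    \sum_(i < r.+1) \sum_(j < r.+1) \sum_(k < r.+1 | (i + j + k == r)%N)
      F i k j.
  apply: eq_bigr => i _; rewrite (exchange_big_dep predT) //=.
  by apply: eq_bigr => k _; apply: eq_bigl => j; rewrite addnAC.
rewrite /= opprB addrA addrAC !mtE.
rewrite [in RHS](swap (fun i j k =>
  nat_m D i (mt D (constS x) (constS y) j) (at_ D (constS z) k))).
rewrite [in RHS](swap (fun i j k =>
  nat_m D i (mt D (constS x) (constS z) j) (at_ D (constS y) k))).
rewrite -sumrB -big_split; apply: eq_bigr => i _.
rewrite -sumrB -big_split; apply: eq_bigr => j _.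
rewrite -sumrB -big_split; apply: eq_bigr => k _.
by rewrite !(at_const, mt_const).
Qed.

Lemma mult_coefE r x y :
  let X := constS x in let Y := constS y in
  mult_coef r x y = at_ D (mt D X Y) r - mt D (at_ D X) (at_ D Y) r.
Proof.
rewrite /= [RHS]addrC at_E mtE; congr (- _ + _).
  by do 3![apply: eq_bigr => ? _]; rewrite !at_const.
by do 2![apply: eq_bigr => ? _]; rewrite mt_const.
Qed.

Lemma is_deformationP :
  is_deformation D <->
  [/\ nat_m D 0 =2 bracket A, nat_a D 0 =1 twist A,
      forall r, (r <= n)%N -> forall x y z, leibniz_coef r x y z = 0
    & forall r, (r <= n)%N -> forall x y, mult_coef r x y = 0].
Proof.
split=> [[m0 a0 eqL eqM]|[m0 a0 eqL eqM]]; split.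
- by move=> x y; rewrite (nat_m_ord ord0) m0.
- by move=> x; rewrite (nat_a_ord ord0) a0.
- by move=> r rn x y z; rewrite leibniz_coefE eqL // subrr.
- by move=> r rn x y; rewrite mult_coefE eqM // subrr.
- by move=> x y; rewrite -m0 -nat_m_ord.
- by move=> x; rewrite -a0 -nat_a_ord.
- move=> x y z X Y Z r rn; apply/eqP; rewrite -subr_eq0 -leibniz_coefE.
  by rewrite eqL.
move=> x y X Y r rn; apply/eqP; rewrite eq_sym -subr_eq0 -mult_coefE.
by rewrite eqM.
Qed.

End Coefficients.

(** * Appending a term of order [n.+1] *)

Section AddTerm.
Variables (n : nat) (D : 'I_n.+1 -> CL2G rho) (c : CL2G rho).
Local Notation D' := (add_term D c).

Lemma nat_m_add_term i : (i <= n)%N -> nat_m D' i =2 nat_m D i.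
Proof.
move=> i_n x y; have [k ->] : exists k : 'I_n.+1, i = k.
  by exists (Ordinal (i_n : (i < n.+1)%N)).
(* Only on the left is [k] read as [lift ord_max k], so that [unlift] in [add_term] returns the old
   coefficient. *)
by rewrite -{1}(lift_max k) !nat_m_ord /coef_m /add_term liftK.
Qed.

Lemma nat_a_add_term i : (i <= n)%N -> nat_a D' i =1 nat_a D i.
Proof.
move=> i_n x; have [k ->] : exists k : 'I_n.+1, i = k.
  by exists (Ordinal (i_n : (i < n.+1)%N)).
by rewrite -{1}(lift_max k) !nat_a_ord /coef_a /add_term liftK.
Qed.

Lemma nat_m_add_term_max : nat_m D' n.+1 =2 (sval c).1.
Proof.
by move=> x y; rewrite (nat_m_ord _ ord_max) /coef_m /add_term unlift_none.
Qed.

Lemma nat_a_add_term_max : nat_a D' n.+1 =1 (sval c).2.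
Proof.
by move=> x; rewrite (nat_a_ord _ ord_max) /coef_a /add_term unlift_none.
Qed.

Lemma leibniz_coef_add_term r x y z : (r <= n)%N ->
  leibniz_coef D' r x y z = leibniz_coef D r x y z.
Proof.
move=> rn; have le_n (i : 'I_r.+1) : (i <= n)%N by have := ltn_ord i; lia.
by do 3![apply: eq_bigr => ? _];
   rewrite /nat_circ !(nat_m_add_term, nat_a_add_term).
Qed.

Lemma mult_coef_add_term r x y : (r <= n)%N ->
  mult_coef D' r x y = mult_coef D r x y.
Proof.
move=> rn; have le_n (i : 'I_r.+1) : (i <= n)%N by have := ltn_ord i; lia.
congr (- _ + _).
  by do 3![apply: eq_bigr => ? _]; rewrite !(nat_m_add_term, nat_a_add_term).
by do 2![apply: eq_bigr => ? _]; rewrite !(nat_m_add_term, nat_a_add_term).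
Qed.

Hypotheses (m0 : nat_m D 0 =2 bracket A) (a0 : nat_a D 0 =1 twist A).

(** With [(phi, psi)] the appended pair, the corners [(n+1,0,0)] and [(0,0,n+1)] together give
    [d_gg phi], and [(0,n+1,0)] gives [- d_ag psi]. *)
Lemma leibniz_coef_add_term_max x y z :
  leibniz_coef D' n.+1 x y z = obs_g D x y z + bd_g A (sval c) x y z.
Proof.
rewrite /leibniz_coef.
rewrite (sum3_ord_recr (fun i j k => nat_circ D' i j k x y z)); congr (_ + _).
  do 3![apply: eq_bigr => ? _]; rewrite /nat_circ.
  rewrite !nat_m_add_term -1?ltnS ?ltn_ord //.
  by rewrite !nat_a_add_term -1?ltnS ?ltn_ord // !nat_m_ord !nat_a_ord.
rewrite /nat_circ !(nat_m_add_term_max, nat_a_add_term_max).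
rewrite !(nat_m_add_term, nat_a_add_term) // !(m0, a0).
rewrite /bd_g /d_gg /d_ag !opprB !addrA.
(* The nine summands of [bd_g] are put in the order of the three corners. *)
by rewrite [RHS](ACl (6*4*5*7*9*8*1*3*2)).
Qed.

Lemma mult_coef_add_term_max x y :
  mult_coef D' n.+1 x y = obs_a D x y + bd_a A (sval c) x y.
Proof.
rewrite /mult_coef.
rewrite (sum3_ord_recr (fun i j k => nat_m D' i (nat_a D' j x) (nat_a D' k y))).
rewrite (sum2_ord_recr (fun i j => nat_a D' i (nat_m D' j x y))).
rewrite opprD addrACA; congr (_ + _).
  congr (- _ + _).
    do 3![apply: eq_bigr => ? _].
    rewrite nat_m_add_term -1?ltnS ?ltn_ord //.
    by rewrite !nat_a_add_term -1?ltnS ?ltn_ord // nat_m_ord !nat_a_ord.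
  (* Positivity of both indices in [obs_a] is automatic: each is at most [n] while their sum is
     [n.+1]. *)
  apply: eq_bigr => i _; apply: eq_big => [j|j _].
    have := ltn_ord i; have := ltn_ord j; lia.
  rewrite nat_m_add_term -1?ltnS ?ltn_ord //.
  by rewrite nat_a_add_term -1?ltnS ?ltn_ord // nat_m_ord nat_a_ord.
rewrite !(nat_m_add_term_max, nat_a_add_term_max).
rewrite !(nat_m_add_term, nat_a_add_term) // !(m0, a0).
rewrite /bd_a /d_ga /d_aa opprB !opprD !addrA.
by rewrite [RHS](ACl (2*5*4*3*1)).
Qed.

End AddTerm.

Lemma is_deformation_add_term n (D : 'I_n.+1 -> CL2G rho) (c : CL2G rho) :
  is_deformation D ->
  is_deformation (add_term D c) <->
  (forall x y z, obs_g D x y z = - bd_g A (sval c) x y z) /\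
  (forall x y, obs_a D x y = - bd_a A (sval c) x y).
Proof.
move=> /is_deformationP[m0 a0 eqL eqM].
rewrite is_deformationP; split=> [[_ _ eqL' eqM']|[eqL' eqM']].
  split=> [x y z|x y]; apply/eqP; rewrite -addr_eq0.
    by rewrite -leibniz_coef_add_term_max // eqL'.
  by rewrite -mult_coef_add_term_max // eqM'.
split=> [x y|x|r|r]; rewrite ?nat_m_add_term ?nat_a_add_term //.
  (* Order [n.+1] is the new equation; lower orders are inherited from [D]. *)
  rewrite leq_eqVlt => /orP[/eqP-> x y z|rn x y z].
    by rewrite leibniz_coef_add_term_max // eqL' addNr.
  by rewrite leibniz_coef_add_term // eqL.
rewrite leq_eqVlt => /orP[/eqP-> x y|rn x y].
  by rewrite mult_coef_add_term_max // eqM' addNr.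
by rewrite mult_coef_add_term // eqM.
Qed.

End Extension.

Theorem theorem7p5 (K : fieldType) (charK0 : [pchar K] =i pred0)
    (G : finGroupType) (L : lmodType K) (A : homLeibniz L)
    (multA : is_multiplicative A) (rho : homLeibniz_action A G)
    (n : nat) (n_ge1 : (1 <= n)%N) (D : 'I_n.+1 -> CL2G rho)
    (defD : is_deformation D) :
  extends_deformation D <-> exists c : CL2G rho, obsG D = coboundaryG c.
Proof.
split=> [[c /(is_deformation_add_term c defD)[eqg eqa]]|[c eq_obs]].
  exists (opp_CL2G c); apply: boolp.eq_exist; apply: CL3_ext => /= [x y z|x y].
    by rewrite eqg -bd_gN.
  by rewrite eqa -bd_aN.
exists (opp_CL2G c); apply/is_deformation_add_term => //.
(* Forgetting the equivariance proofs gives an equality of plain cochains, whose components can then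
   be compared pointwise. *)
have eq3 : obs D = coboundary A (sval c).
  by rewrite -[LHS]/(sval (obsG D)) eq_obs.
split=> [x y z|x y] /=; rewrite ?bd_gN ?bd_aN opprK.
  by rewrite -[LHS]/(sval (obs D).1 x y z) eq3.
by rewrite -[LHS]/((obs D).2 x y) eq3.
Qed.
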